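(* Let $n\ge 2k\ge 2$ and $i\in\{0,1,\ldots,k-1\}$. The generalized Johnson graph $J(n,k,i)$ admits perfect state transfer if and only if $n=2k$ and $i=0$.
   Context: For integers $n\ge 2k$ and $0\le i\le k$, $J(n,k,i)$ is the graph whose vertices are the $k$-subsets of $\{1,\ldots,n\}$, with $A\sim B$ iff $|A\cap B|=i$ (so $J(n,k,0)$ is the Kneser graph). For a simple graph $X$ with adjacency matrix $A$, let $\mathcal{H}_X(t)=e^{itA}$. $X$ admits perfect state transfer (PST) from a vertex $u$ to a vertex $v\neq u$ at time $\tau>0$ if $|\mathcal{H}_X(\tau)_{u,v}|=1$; $X$ admits PST if this happens for some $u\ne v$ and some $\tau>0$. *)

(* Defs.v *)
From Stdlib Require Import Reals Factorial.
From mathcomp Require Import all_boot.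

Set Implicit Arguments.
Unset Strict Implicit.
Unset Printing Implicit Defensive.

Fixpoint adjpow (V : finType) (adj : rel V) (m : nat) (u v : V) : nat :=
  match m with
  | 0 => nat_of_bool (u == v)
  | m'.+1 => \sum_(w : V | adj u w) adjpow adj m' w v
  end.

(* H(t) = e^{itA} = sum_m (it)^m A^m / m!.  Since A is real, the real part of
   H(t)_{u,v} is sum_j (-1)^j t^(2j) (A^(2j))_{uv} / (2j)! and the imaginary
   part is sum_j (-1)^j t^(2j+1) (A^(2j+1))_{uv} / (2j+1)!. *)
Definition H_re_term (V : finType) (adj : rel V) (t : R) (u v : V) (j : nat) : R :=
  Rdiv (Rmult (Rmult (pow (Ropp R1) j) (pow t (2 * j)%N))
              (INR (adjpow adj (2 * j)%N u v)))
       (INR (fact (2 * j)%N)).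

Definition H_im_term (V : finType) (adj : rel V) (t : R) (u v : V) (j : nat) : R :=
  Rdiv (Rmult (Rmult (pow (Ropp R1) j) (pow t (2 * j + 1)%N))
              (INR (adjpow adj (2 * j + 1)%N u v)))
       (INR (fact (2 * j + 1)%N)).

Definition PST_at (V : finType) (adj : rel V) (u v : V) (tau : R) : Prop :=
  exists re im : R,
    infinite_sum (H_re_term adj tau u v) re /\
    infinite_sum (H_im_term adj tau u v) im /\
    Rplus (Rmult re re) (Rmult im im) = R1.

Definition admits_PST (V : finType) (adj : rel V) : Prop :=
  exists (u v : V) (tau : R), u <> v /\ Rlt R0 tau /\ PST_at adj u v tau.

Definition J_vertex (n k : nat) : finType := {A : {set 'I_n} | #|A| == k}.

Definition J_adj (n k i : nat) : rel (J_vertex n k) :=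
  fun A B => #|val A :&: val B| == i.
Arguments J_adj n k i : clear implicits.

(* Main.v *)
Require Import Defs.
From Stdlib Require Import Reals Factorial Lra.
From mathcomp Require Import all_boot.
From mathcomp Require Import all_algebra all_fingroup Rstruct zify.
From Coquelicot Require Import Coquelicot.

(** For a symmetric relation the column of v in H(t) = e^{itA} has norm 1, so
  perfect state transfer from u to v makes it vanish outside u. As H(t) commutes
  with the permutations of the ground set, every permutation fixing v must then
  fix u; this forces u to be the complement of v, hence n = 2k.

  For n = 2k, match v with its complement in k pairs. The product over the first
  j pairs (a, b) of [a in B] - [b in B] is an eigenvector of A; it equals 1 at v
  and (-1)^j at u, and its eigenvalue L_j is the coefficient of x^i y^(k-i) in
  (x - y)^j ((1 + x)(1 + y))^(k-j). Transfer at time t therefore gives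
  cos((L_j - L_l) t) = (-1)^(j+l). With c = C(k-1, i), the values
  L_k - L_(k-1) = +-2c and L_0 - L_1 = 2 c C(k, i) make C(k, i) odd. Moreover
  L_k - L_(k-m) = 2 C(k-m, i-m/2) mod 4 when m is a power of 2 and
  2 <= m <= min(k, 2i), and comparing with L_k - L_(k-1) makes all these
  C(k-m, i-m/2) even. By Lucas' theorem at least one of them is odd if C(k, i) is
  odd and 0 < i < k; hence i = 0. *)

Import GRing.Theory Num.Theory.

Set Implicit Arguments.
Unset Strict Implicit.
Unset Printing Implicit Defensive.

Local Open Scope nat_scope.

(** * Binomial coefficients modulo 2 and 4 *)

Lemma odd_bin_even (a b : nat) : odd 'C(a.*2, b.*2) = odd 'C(a, b)
 /\ odd 'C(a.*2, b.*2.+1) = false.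
Proof.
elim: a b => [|a IHa] [|b] //=; rewrite ?bin0 //.
  split=> //; rewrite doubleS bin1 //= odd_double //.
have [h1 h2] := IHa b; have [h3 h4] := IHa b.+1.
rewrite doubleS in h3 h4; rewrite !doubleS !binS !oddD h1 h2 h3 h4.
by case: (odd _) (odd _) => [] [].
Qed.

Lemma odd_binE (a b : nat) : odd 'C(a.*2, b.*2) = odd 'C(a, b).
Proof. by case: (odd_bin_even a b). Qed.

Lemma odd_binEO (a b : nat) : odd 'C(a.*2, b.*2.+1) = false.
Proof. by case: (odd_bin_even a b). Qed.

Lemma odd_binOE (a b : nat) : odd 'C(a.*2.+1, b.*2) = odd 'C(a, b).
Proof.
case: b => [|b]; first by rewrite !bin0.
by rewrite doubleS binS oddD -doubleS odd_binE odd_binEO addbF.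
Qed.

Lemma odd_binOO (a b : nat) : odd 'C(a.*2.+1, b.*2.+1) = odd 'C(a, b).
Proof. by rewrite binS oddD odd_binE odd_binEO. Qed.

(** By Lucas, halving [k] and [i] keeps the binomial odd, and a witness for the halves gives its
    successor for [k] and [i]. When the halves violate 0 < i < k, [k] is odd and [i] is 1 or k - 1;
    then a = 0 works, as C(k-2, 0) and C(k-2, k-2) are 1. *)
Lemma odd_bin_descent (k i : nat) : 0 < i -> i < k -> odd 'C(k, i) ->
  exists a, [/\ 2 ^ a.+1 <= k, 2 ^ a <= i & odd 'C(k - 2 ^ a.+1, i - 2 ^ a)].
Proof.
elim/ltn_ind: k i => k IHk i i0 ik.
have IH : odd 'C(k./2, i./2) -> 0 < i./2 -> i./2 < k./2 -> (odd i <= odd k) ->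
    exists a, [/\ 2 ^ a.+1 <= k, 2 ^ a <= i & odd 'C(k - 2 ^ a.+1, i - 2 ^ a)].
  move=> hC i20 ik2 dle.
  have hk : k./2 < k by lia.
  have [a [h1 h2 h3]] := IHk _ hk _ i20 ik2 hC.
  exists a.+1; have E1 : 2 ^ a.+2 = (2 ^ a.+1).*2 by rewrite expnS mul2n.
  have E2 : 2 ^ a.+1 = (2 ^ a).*2 by rewrite expnS mul2n.
  have ek : k - 2 ^ a.+2 = odd k + (k./2 - 2 ^ a.+1).*2 by lia.
  have ei : i - 2 ^ a.+1 = odd i + (i./2 - 2 ^ a).*2 by lia.
  split; [lia|lia|rewrite ek ei].
  by case: (odd i) (odd k) dle => [] [] //= _; rewrite ?add0n ?add1n
    ?odd_binE ?odd_binOE ?odd_binOO.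
rewrite -{1}(odd_double_half k) -{1}(odd_double_half i).
case Ek: (odd k) IH; case Ei: (odd i) => IH; rewrite ?add0n ?add1n
    ?odd_binE ?odd_binOE ?odd_binOO ?odd_binEO // => hC.
- have [i2|i2] := posnP i./2; last by apply: IH => //; lia.
  have i1 : i = 1 by lia.
  exists 0; rewrite i1 expn0 subnn bin0 expn1; split=> //; lia.
- have [i2|i2] := leqP k./2 i./2; last by apply: IH => //; lia.
  exists 0; rewrite expn0 expn1; split; [lia|lia|].
  by rewrite (_ : k - 2 = i - 1) ?binn //; lia.
- by apply: IH => //; lia.
Qed.

(** With m = 2^(a+1), s C(m, s) = m C(m-1, s-1). If C(m, s) had 2-adic valuation below 2, then 2^a
    would divide s, which leaves only s = 2^a. *)
Lemma dvdn4_bin_pow2 (a s : nat) : 0 < s -> s < 2 ^ a.+1 -> s <> 2 ^ a ->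
  4 %| 'C(2 ^ a.+1, s).
Proof.
case: s => // s _ sa ns.
have := mul_bin_diag (2 ^ a.+1) s; set C := 'C(_, _.+1); set D := 'C(_, _) => E.
have C0 : 0 < C by rewrite bin_gt0 ltnW.
have D0 : 0 < D by rewrite bin_gt0; lia.
have := congr1 (logn 2) E; rewrite !lognM ?expn_gt0 // pfactorK // => E2.
rewrite -[4]/(2 ^ 2) pfactor_dvdn //; case: leqP => // lC.
have : 2 ^ a %| s.+1 by rewrite pfactor_dvdn //; lia.
case/dvdnP => q Eq; move: sa ns; rewrite Eq expnS ltn_mul2r expn_gt0 /=.
by case: q Eq => [|[|q]] Eq //; lia.
Qed.

(** C(2h, h) = 2 C(2h-1, h-1); for h = 2^a the right-hand binomial is odd, since all binary digits
    of 2h-1 and h-1 are ones. *)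
Lemma bin_pow2_mod4 (a : nat) : exists2 q, odd q & 'C(2 ^ a.+1, 2 ^ a) = q.*2.
Proof.
exists 'C((2 ^ a.+1).-1, (2 ^ a).-1).
  elim: a => // a IHa.
  have E b : (2 ^ b.+1).-1 = (2 ^ b).-1.*2.+1.
    by have := expn_gt0 2 b; rewrite expnS /=; lia.
  by rewrite (E a.+1) [(2 ^ a.+1).-1 in X in 'C(_, X)]E odd_binOO.
have p := expn_gt0 2 a; apply/eqP; rewrite -(eqn_pmul2l p) /=.
have := mul_bin_diag (2 ^ a.+1) (2 ^ a).-1.
rewrite prednK // => <-; rewrite expnS; lia.
Qed.

(** * Vertices of the generalized Johnson graph *)

Lemma J_adj_sym (n k i : nat) : symmetric (J_adj n k i).
Proof. by move=> A B; rewrite /J_adj setIC. Qed.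

Lemma card_J_vertex (n k : nat) (A : J_vertex n k) : #|val A| = k.
Proof. exact/eqP/(valP A). Qed.

Lemma card_imset_vertex (n k : nat) (s : {perm 'I_n}) (A : J_vertex n k) :
  #|s @: val A| == k.
Proof. by rewrite card_imset ?(valP A) //; exact: perm_inj. Qed.

Definition perm_vertex (n k : nat) (s : {perm 'I_n}) (A : J_vertex n k) : J_vertex n k :=
  Sub (s @: val A) (card_imset_vertex s A).

Lemma perm_vertex_bij (n k : nat) (s : {perm 'I_n}) : bijective (@perm_vertex n k s).
Proof.
apply: injF_bij => A B /(congr1 val); rewrite !SubK => /imset_inj h.
exact/val_inj/h/perm_inj.
Qed.

Lemma J_adj_perm (n k i : nat) (s : {perm 'I_n}) :
  {mono @perm_vertex n k s : A B / J_adj n k i A B}.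
Proof.
move=> A B; rewrite /J_adj !SubK -imsetI; last by move=> x y _ _; exact: perm_inj.
by rewrite card_imset //; exact: perm_inj.
Qed.

Lemma tperm_imset_id (T : finType) (A : {set T}) (x y : T) :
  (x \in A) = (y \in A) -> tperm x y @: A = A.
Proof.
move=> xy; apply/setP=> z; rewrite -{1}(tpermK x y z) mem_imset; last exact: perm_inj.
by case: tpermP => // ->.
Qed.

Section Pairing.
Variables (k : nat) (S : {set 'I_(2 * k)}).
Hypothesis cardS : #|S| = k.

Lemma card_setC_half : #|~: S| = k.
Proof. by have := cardsC S; rewrite cardS card_ord; lia. Qed.

(** A perfect matching between [S] and its complement, the boolean telling the side; the
    eigenvectors are built on it. *)
Definition half_pairing (p : 'I_k * bool) : 'I_(2 * k) :=
  if p.2 then enum_val (cast_ord (esym cardS) p.1)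
  else enum_val (cast_ord (esym card_setC_half) p.1).

Lemma half_pairing_in (l : 'I_k) (b : bool) : (half_pairing (l, b) \in S) = b.
Proof.
rewrite /half_pairing /=; case: b; first exact: enum_valP.
by have := enum_valP (cast_ord (esym card_setC_half) l); rewrite inE => /negbTE.
Qed.

Lemma half_pairing_bij : bijective half_pairing.
Proof.
apply: inj_card_bij; last by rewrite card_prod !card_ord card_bool; lia.
move=> [l b] [l' b'] e; have := half_pairing_in l b; rewrite e half_pairing_in => bE.
move: e; rewrite /half_pairing bE /=.
by case: b {bE} => /enum_val_inj /cast_ord_inj ->.
Qed.

End Pairing.

(** * The columns of e^{itA} *)

Delimit Scope R_scope with coqR.

Section Graph.
Variables (V : finType) (adj : rel V).

(** [adjpow] splits off the first step of a walk; splitting off the last one allows walks to be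
    reversed by induction. *)
Lemma adjpowSr (m : nat) (u v : V) :
  adjpow adj m.+1 u v = \sum_(w | adj w v) adjpow adj m u w.
Proof.
elim: m u => [|m IHm] u.
  rewrite /= (eq_bigr (fun w => if w == v then 1 else 0)); last by move=> w _; case: eqP.
  rewrite -big_mkcondr [RHS](eq_bigr (fun w => if w == u then 1 else 0)); last first.
    by move=> w _; rewrite eq_sym; case: eqP.
  rewrite -big_mkcondr; case uv: (adj u v).
    by rewrite (big_pred1 v) ?(big_pred1 u) // => w; rewrite /= andbC; case: eqP => // ->.
  by rewrite !big_pred0 // => w; rewrite andbC; case: eqP => // ->.
rewrite -[LHS]/(\sum_(w | adj u w) adjpow adj m.+1 w v).
under eq_bigr do rewrite IHm.
by rewrite exchange_big.
Qed.

Lemma adjpow_sym (m : nat) (u v : V) : symmetric adj ->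
  adjpow adj m u v = adjpow adj m v u.
Proof.
move=> sadj; elim: m u v => [|m IHm] u v; first by rewrite /= eq_sym.
by rewrite adjpowSr /=; apply: eq_big => w; rewrite ?[adj w v]sadj // IHm.
Qed.

Lemma adjpow_aut (s : V -> V) (m : nat) (u v : V) : bijective s ->
  {mono s : x y / adj x y} -> adjpow adj m (s u) (s v) = adjpow adj m u v.
Proof.
move=> sb sM; elim: m u => [|m IHm] u /=; first by rewrite bij_eq.
rewrite (reindex s) /=; last exact: onW_bij.
by apply: eq_big => w; rewrite ?sM // IHm.
Qed.

Lemma adjpow_le (m : nat) (u v : V) : adjpow adj m u v <= #|V| ^ m.
Proof.
elim: m u => [|m IHm] u /=; first by case: eqP.
apply: (@leq_trans (\sum_(w : V) #|V| ^ m)); last by rewrite sum_nat_const expnS.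
by rewrite [leqLHS]big_mkcond leq_sum // => w _; case: ifP.
Qed.

End Graph.

(** * Exponential power series *)

Local Open Scope R_scope.

(** Here [r] stands for the real or imaginary part of i^m, and [b] for an entry of A^m or the power
    of an eigenvalue. Differentiation merely shifts both sequences. *)
Definition expc (r b : nat -> R) (m : nat) : R := r m * b m / INR (fact m).

(* Real and imaginary parts of i^m. *)
Definition rho (m : nat) : R := if odd m then 0 else (-1) ^ m./2.
Definition sgm (m : nat) : R := if odd m then (-1) ^ m./2 else 0.

Lemma rhoS (m : nat) : rho m.+1 = - sgm m.
Proof.
rewrite /rho /sgm /=; case E: (odd m) => /=; last by lra.
by rewrite uphalf_half E add1n /=; lra.
Qed.

Lemma sgmS (m : nat) : sgm m.+1 = rho m.
Proof. by rewrite /rho /sgm /= uphalf_half; case: (odd m). Qed.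

Lemma rho_le (m : nat) : Rabs (rho m) <= 1.
Proof. by rewrite /rho; case: ifP => _; rewrite ?Rabs_R0 ?pow_1_abs; lra. Qed.

Lemma sgm_le (m : nat) : Rabs (sgm m) <= 1.
Proof. by rewrite /sgm; case: ifP => _; rewrite ?Rabs_R0 ?pow_1_abs; lra. Qed.

Section Radius.
Variables (r b : nat -> R) (M : R).
Hypotheses (r_le : forall m, Rabs (r m) <= 1) (b_le : forall m, Rabs (b m) <= M ^ m).

(** Comparison with the series of exp(M |x|). *)
Lemma CV_disk_expc (x : R) : CV_disk (expc r b) x.
Proof.
apply: (@ex_series_le R_AbsRing R_CompleteNormedModule _
         (fun m => (M * Rabs x) ^ m * / INR (fact m))); last first.
  exists (exp (M * Rabs x)); have := is_exp_Reals (M * Rabs x).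
  by apply: is_series_ext => m; rewrite /scal /= /mult /= pow_n_pow.
move=> m; rewrite /norm /= /abs /= Rabs_Rabsolu /expc.
have f0 : 0 < / INR (fact m) by apply: Rinv_0_lt_compat; exact: INR_fact_lt_0.
rewrite /Rdiv !Rabs_mult (Rabs_right (/ _)); last by lra.
rewrite -RPow_abs Rpow_mult_distr.
have p0 : 0 <= Rabs x ^ m by apply: pow_le; exact: Rabs_pos.
have := r_le m; have := b_le m; have := Rabs_pos (r m); have := Rabs_pos (b m).
set X := Rabs x ^ m in p0 *; set I := / _ in f0 *; set B := M ^ m => h1 h2 h3 h4.
have : Rabs (r m) * Rabs (b m) <= 1 * B by apply: Rmult_le_compat.
have : 0 <= I * X by apply: Rmult_le_pos; lra.
nra.
Qed.

Lemma CV_radius_expc (x : R) : Rbar_lt (Rabs x) (CV_radius (expc r b)).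
Proof.
apply: Rbar_not_le_lt => le.
(* A point beyond |x|: if the radius were at most |x|, the terms at |x| + 1 could not tend to 0. *)
have d := CV_disk_correct _ _ (CV_disk_expc (Rabs x + 1)).
apply: (@CV_disk_outside (expc r b) (Rabs x + 1)).
  apply: (Rbar_le_lt_trans _ _ _ le); have x0 := Rabs_pos x.
  by rewrite /= (Rabs_right (Rabs x + 1)); lra.
have := ex_series_lim_0 _ d; apply: is_lim_seq_ext => m.
by rewrite /scal /= /mult /= pow_n_pow Rmult_comm.
Qed.

Lemma is_pseries_expc (x : R) : is_pseries (expc r b) x (PSeries (expc r b) x).
Proof. exact: PSeries_correct _ _ (CV_disk_correct _ _ (CV_disk_expc x)). Qed.

End Radius.

(* Coquelicot states its equations at canonical structures, where ring does not recognize R. *)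
Ltac eqR := match goal with |- @eq _ ?a ?b => change (@eq R a b) end.

Lemma is_series_0 (a : nat -> R) : (forall m, a m = 0) -> is_series a 0.
Proof.
move=> a0; apply/is_series_Reals => eps e0; exists 0%N => n _.
by rewrite /Rdist sum_eq_R0 // Rminus_0_r Rabs_R0.
Qed.

(** The given series is the even half of the power series in [t]; the odd half is zero. *)
Lemma is_pseries_expc_rho (b : nat -> R) (t l : R) :
  is_series (fun j => (-1) ^ j * t ^ (2 * j)%N * b (2 * j)%N / INR (fact (2 * j)%N)) l ->
  is_pseries (expc rho b) t l.
Proof.
move=> h; rewrite -[l]Rplus_0_r -(Rmult_0_r t).
have scalE (x y : R) : scal x y = x * y by [].
apply: is_pseries_odd_even.
  move: h; apply: is_series_ext => j.
  rewrite scalE pow_n_pow -pow_mult multE /expc /rho oddM [odd 2]/= /=.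
  by rewrite mul2n half_double /Rdiv; ring.
apply: is_series_0 => j.
by rewrite scalE plusE multE addn1 /expc /rho /= oddM /= /Rdiv; ring.
Qed.

(** Now the even half is zero, and the odd half is [t] times a series in [t ^ 2]. *)
Lemma is_pseries_expc_sgm (b : nat -> R) (t l : R) :
  is_series (fun j => (-1) ^ j * (t ^ 2) ^ j * b (2 * j + 1)%N / INR (fact (2 * j + 1)%N)) l ->
  is_pseries (expc sgm b) t (t * l).
Proof.
move=> h; rewrite -[t * l]Rplus_0_l.
have scalE (x y : R) : scal x y = x * y by [].
apply: is_pseries_odd_even.
  by apply: is_series_0 => j; rewrite scalE multE /expc /sgm oddM [odd 2]/= /= /Rdiv; ring.
move: h; apply: is_series_ext => j.
rewrite scalE pow_n_pow plusE multE /expc /sgm addn1 [odd _]/= oddM [odd 2]/=.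
by rewrite [_./2]/= mul2n uphalf_double /Rdiv /=; ring.
Qed.

Lemma Rsqr_pow (l t : R) (j : nat) : Rsqr (l * t) ^ j = t ^ (2 * j)%N * l ^ (2 * j)%N.
Proof.
by rewrite -multE !pow_mult -Rpow_mult_distr; congr (_ ^ _); rewrite /Rsqr; ring.
Qed.

Lemma is_pseries_expc_cos (l t : R) :
  is_pseries (expc rho (fun m => l ^ m)) t (cos (l * t)).
Proof.
apply: is_pseries_expc_rho; rewrite /cos; case: exist_cos => c hc.
have /is_series_Reals := hc; apply: is_series_ext => j.
by rewrite /cos_n Rsqr_pow multE /Rdiv; eqR; ring.
Qed.

Lemma is_pseries_expc_sin (l t : R) :
  is_pseries (expc sgm (fun m => l ^ m)) t (sin (l * t)).
Proof.
rewrite /sin; case: exist_sin => c hc.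
have -> : l * t * c = t * (l * c) by ring.
apply: is_pseries_expc_sgm; have /is_series_Reals := hc => /(is_series_scal_l l).
apply: is_series_ext => j; rewrite /sin_n Rsqr_pow.
rewrite -pow_mult plusE multE; eqR.
by rewrite -[scal _ _]/(Rmult _ _) /Rdiv [l ^ (_ + 1)%N]pow_add pow_1; ring.
Qed.

(** * The propagator: differential equation, norm and eigenvectors *)

Section Propagator.
Variables (V : finType) (adj : rel V) (v : V).
Local Open Scope ring_scope.

Definition Hcoef (r : nat -> R) (u : V) : nat -> R :=
  expc r (fun m => INR (adjpow adj m u v)).
(** The real ([rho]) or imaginary ([sgm]) part of the entry (u, v) of H(t), as a function of
    time. *)
Definition Hcol (r : nat -> R) (u : V) : R -> R := PSeries (Hcoef r u).

Lemma adjpow_Rle (m : nat) (u : V) : (Rabs (INR (adjpow adj m u v)) <= (INR #|V|) ^ m)%coqR.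
Proof.
rewrite Rabs_right; last by apply: Rle_ge; exact: pos_INR.
have -> : (INR #|V| ^ m)%coqR = INR (#|V| ^ m)%N by rewrite !INRE RpowE natrX.
by apply: le_INR; apply/leP; exact: adjpow_le.
Qed.

Lemma is_pseries_Hcol (u : V) (t : R) (r : nat -> R) :
  (forall m, (Rabs (r m) <= 1)%coqR) -> is_pseries (Hcoef r u) t (Hcol r u t).
Proof. by move=> hr; apply: is_pseries_expc hr _ _ => m; exact: adjpow_Rle. Qed.

Lemma is_pseries_sum (P : pred V) (a : V -> nat -> R) (x : R) (l : V -> R) :
  (forall w, is_pseries (a w) x (l w)) ->
  is_pseries (fun m => \sum_(w | P w) a w m) x (\sum_(w | P w) l w).
Proof.
move=> h; elim: (index_enum V) => [|w s IHs].
  rewrite big_nil /is_pseries; apply: is_series_0 => m; rewrite big_nil; exact: Rmult_0_r.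
rewrite big_cons; apply: (@is_pseries_ext _ _ (fun m =>
  if P w then a w m + \sum_(w <- s | P w) a w m else \sum_(w <- s | P w) a w m)).
  by move=> m; rewrite big_cons.
by case: ifP => _ //; apply: is_pseries_plus.
Qed.

(** The equation H' = iAH entrywise: the sum over neighbours is the factor A, the shift of [r] is
    the factor i. *)
Lemma is_derive_Hcol (r : nat -> R) (u : V) (t : R) :
  (forall m, (Rabs (r m) <= 1)%coqR) ->
  is_derive (Hcol r u) t (\sum_(w | adj u w) Hcol (fun m => r m.+1) w t).
Proof.
move=> hr.
have := is_derive_PSeries _ _ (CV_radius_expc hr (fun m => adjpow_Rle m u) t).
rewrite -/(Hcol r u); congr is_derive; apply: is_pseries_unique.
have := @is_pseries_sum (adj u) _ t _
  (fun w => @is_pseries_Hcol w t (fun m => r m.+1) (fun m => hr m.+1)).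
apply: is_pseries_ext => m; rewrite /PS_derive /Hcoef /expc.
rewrite [adjpow _ m.+1 _ _]/= fact_simpl mult_INR INRE.
have -> : INR (\sum_(w | adj u w) adjpow adj m w v)
  = \sum_(w | adj u w) INR (adjpow adj m w v).
  by rewrite INRE natr_sum; apply: eq_bigr => w _; rewrite INRE.
have h1 := INR_fact_neq_0 m; have h2 := not_0_INR m.+1.
rewrite -INRE /Rdiv.
transitivity (r m.+1 * (\sum_(w | adj u w) INR (adjpow adj m w v)) * (/ INR (fact m)))%coqR.
  by rewrite !RmultE mulr_sumr mulr_suml; apply: eq_bigr.
by eqR; field; split => //; apply: h2.
Qed.

Lemma Hcol_rhoS (u : V) (t : R) : Hcol (fun m => rho m.+1) u t = - Hcol sgm u t.
Proof.
rewrite /Hcol -[RHS]PSeries_opp; apply: PSeries_ext => m.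
by rewrite /PS_opp /Hcoef /expc rhoS /opp /= /Rdiv; eqR; ring.
Qed.

Lemma Hcol_sgmS (u : V) (t : R) : Hcol (fun m => sgm m.+1) u t = Hcol rho u t.
Proof. by apply: PSeries_ext => m; rewrite /Hcoef /expc sgmS. Qed.

Lemma is_derive_bigsum (f : V -> R -> R) (d : V -> R) (t : R) :
  (forall w, is_derive (f w) t (d w)) ->
  is_derive (fun x => \sum_w f w x) t (\sum_w d w).
Proof.
move=> h; elim: (index_enum V) => [|w s IHs].
  rewrite big_nil; apply: (@is_derive_ext R_AbsRing R_NormedModule (fun=> 0)).
    by move=> x; rewrite big_nil.
  exact: is_derive_const.
rewrite big_cons.
apply: (@is_derive_ext R_AbsRing R_NormedModule (fun x => plus (f w x) (\sum_(w <- s) f w x))).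
  by move=> x; rewrite big_cons.
exact: is_derive_plus.
Qed.

(** The squared norm of the column has derivative 0 and is compared with its value at time 0, where
    the column is the basis vector of [v]. *)
Lemma Hcol_norm (t : R) : symmetric adj -> (0 < t)%coqR ->
  \sum_u (Hcol rho u t * Hcol rho u t + Hcol sgm u t * Hcol sgm u t) = 1.
Proof.
move=> sadj t0; pose N x := \sum_u (Hcol rho u x * Hcol rho u x + Hcol sgm u x * Hcol sgm u x).
rewrite -/(N t) -(@eq_is_derive R_NormedModule N 0 t) //; last first.
  move=> x _.
  have dN w : is_derive (fun x => Hcol rho w x * Hcol rho w x + Hcol sgm w x * Hcol sgm w x) x
      ((\sum_(y | adj w y) (Hcol sgm w x * Hcol rho y x - Hcol rho w x * Hcol sgm y x)) *+ 2).
    have h1 := is_derive_Hcol w x rho_le; have h2 := is_derive_Hcol w x sgm_le.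
    rewrite (eq_bigr _ (fun y _ => Hcol_rhoS y x)) in h1.
    rewrite (eq_bigr _ (fun y _ => Hcol_sgmS y x)) in h2.
    have h11 := is_derive_mult _ _ _ _ _ h1 h1 Rmult_comm.
    have h22 := is_derive_mult _ _ _ _ _ h2 h2 Rmult_comm.
    have := is_derive_plus _ _ _ _ _ h11 h22; congr is_derive.
    rewrite sumrB -!mulr_sumr sumrN mulr2n.
    rewrite [LHS](_ : _ = - (\sum_(y | adj w y) Hcol sgm y x) * Hcol rho w x
        + Hcol rho w x * - (\sum_(y | adj w y) Hcol sgm y x)
        + ((\sum_(y | adj w y) Hcol rho y x) * Hcol sgm w x
        + Hcol sgm w x * \sum_(y | adj w y) Hcol rho y x)) //.
    by rewrite mulrN mulNr ![_ * Hcol _ _ _]mulrC [RHS]addrACA addrC.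
  have := is_derive_bigsum dN; congr is_derive.
  rewrite sumrMnl; under eq_bigr do rewrite sumrB.
  (* Symmetry of [adj] lets the two ends of each edge be exchanged, so the two double sums
     cancel. *)
  rewrite sumrB; have -> : \sum_w \sum_(y | adj w y) Hcol sgm w x * Hcol rho y x
      = \sum_w \sum_(y | adj w y) Hcol rho w x * Hcol sgm y x.
    rewrite (exchange_big_dep xpredT) //=; apply: eq_bigr => w _.
    by apply: eq_big => [y|y _]; rewrite ?[adj y w]sadj // mulrC.
  by rewrite subrr mul0rn.
rewrite /N (bigD1 v) //= big1 ?addr0 => [|w wv].
  rewrite /Hcol !PSeries_0 /Hcoef /expc /= eqxx /rho /sgm /= -!RmultE -!RplusE; eqR.
  by rewrite -R1E; field.
rewrite /Hcol !PSeries_0 /Hcoef /expc /= (negbTE wv) -!RmultE -!RplusE -R0E; eqR.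
by rewrite /Rdiv /=; ring.
Qed.

Lemma PST_at_Hcol (u : V) (t : R) : (0 < t)%coqR -> PST_at adj u v t ->
  Hcol rho u t * Hcol rho u t + Hcol sgm u t * Hcol sgm u t = 1.
Proof.
move=> t0 [re [im [hre [him norm1]]]].
have -> : Hcol rho u t = re.
  apply: is_pseries_unique; apply: is_pseries_expc_rho; apply/is_series_Reals.
  exact: hre.
suff -> : Hcol sgm u t = im by exact: norm1.
(* [is_pseries_expc_sgm] yields a limit with a factor [t] in front, so [im] is divided by [t]
   first. *)
have -> : im = (t * (/ t * im))%coqR by field; lra.
apply: is_pseries_unique; apply: is_pseries_expc_sgm.
have /is_series_Reals/(is_series_scal_l (/ t)%coqR) := him.
apply: is_series_ext => j; eqR; rewrite -[scal _ _]/(Rmult _ _) /H_im_term.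
rewrite -pow_mult multE [(t ^ (_ + 1)%N)%coqR]pow_add pow_1.
have -> : (- R1 = -1)%coqR by lra.
field; split; [exact: INR_fact_neq_0 | lra].
Qed.

Lemma PST_at_Hcol0 (u w : V) (t : R) : symmetric adj -> (0 < t)%coqR -> PST_at adj u v t ->
  w != u -> Hcol rho w t = 0 /\ Hcol sgm w t = 0.
Proof.
move=> sadj t0 /(PST_at_Hcol t0) hu wu; have := Hcol_norm sadj t0.
rewrite (bigD1 u) //= hu (bigD1 w) //= => /(canRL (addKr _)).
rewrite addNr => /eqP.
have sq (x y : R) : 0 <= x * x + y * y by rewrite addr_ge0 // -expr2 sqr_ge0.
rewrite paddr_eq0 //; last by apply: sumr_ge0.
case/andP => + _; rewrite paddr_eq0 -?expr2 ?sqr_ge0 // !sqrf_eq0.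
by case/andP => /eqP-> /eqP->.
Qed.

Lemma adjpow_eigen (f : V -> R) (l : R) (m : nat) (u : V) :
  (forall x, \sum_(w | adj x w) f w = l * f x) ->
  \sum_w (adjpow adj m u w)%:R * f w = l ^+ m * f u.
Proof.
move=> hf; elim: m u => [|m IHm] u.
  rewrite (bigD1 u) //= eqxx big1 ?addr0 ?expr0 // => w wu.
  by rewrite eq_sym (negbTE wu) mul0r.
transitivity (\sum_(x | adj u x) l ^+ m * f x); last first.
  by rewrite -mulr_sumr hf exprS mulrCA mulrA.
under [RHS]eq_bigr do rewrite -IHm.
rewrite exchange_big /=; apply: eq_bigr => w _.
by rewrite natr_sum mulr_suml.
Qed.

(** Pairing the column of [v] with an eigenvector: f^T e^(itA) e_v = e^(itl) f(v), one part at a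
    time. *)
Lemma Hcol_eigen (f : V -> R) (l t : R) (r : nat -> R) : symmetric adj ->
  (forall m, (Rabs (r m) <= 1)%coqR) ->
  (forall x, \sum_(w | adj x w) f w = l * f x) ->
  \sum_w f w * Hcol r w t = f v * PSeries (expc r (fun m => pow l m)) t.
Proof.
move=> sadj hr hf.
have h w : is_pseries (PS_scal (f w) (Hcoef r w)) t (f w * Hcol r w t).
  by apply: is_pseries_scal; [exact: Rmult_comm | exact: is_pseries_Hcol].
have /is_pseries_unique <- := @is_pseries_sum xpredT _ t _ h.
rewrite -[RHS]PSeries_scal; apply: PSeries_ext => m; eqR.
rewrite /PS_scal /Hcoef /expc -![scal _ _]/(Rmult _ _).
have e := adjpow_eigen m v hf.
transitivity (r m * (\sum_w (adjpow adj m v w)%:R * f w) * / INR (fact m))%coqR.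
  rewrite !RmultE mulr_sumr mulr_suml; apply: eq_bigr => w _.
  by rewrite -[scal _ _]/(Rmult _ _) adjpow_sym // -INRE -!RmultE /Rdiv; eqR; ring.
by rewrite e -RpowE -!RmultE /Rdiv; ring.
Qed.

(** Under transfer only the entry at [u] survives in the pairing of [Hcol_eigen]. *)
Lemma PST_at_eigen (f : V -> R) (l t : R) (u : V) : symmetric adj -> (0 < t)%coqR ->
  PST_at adj u v t -> (forall x, \sum_(w | adj x w) f w = l * f x) ->
  f u * Hcol rho u t = f v * cos (l * t) /\ f u * Hcol sgm u t = f v * sin (l * t).
Proof.
move=> sadj t0 pst hf; have H0 w (wu : w != u) := PST_at_Hcol0 sadj t0 pst wu.
have h r : (forall m, (Rabs (r m) <= 1)%coqR) -> (forall w, w != u -> Hcol r w t = 0) ->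
    f u * Hcol r u t = f v * PSeries (expc r (fun m => pow l m)) t.
  move=> hr r0; rewrite -(Hcol_eigen t sadj hr hf) (bigD1 u) //= big1 ?addr0 // => w wu.
  by rewrite r0 ?mulr0.
split; rewrite h //.
all: try by [exact: rho_le | exact: sgm_le | move=> w /H0[]].
  by rewrite (is_pseries_unique _ _ _ (@is_pseries_expc_cos l t)).
by rewrite (is_pseries_unique _ _ _ (@is_pseries_expc_sin l t)).
Qed.

End Propagator.

(** * Transfer only between complementary sets *)

Local Open Scope ring_scope.

(* A transposition fixing v but moving u would make the column of v in H(t) take
   the modulus 1 at two vertices. *)
Lemma PST_at_separates (n k i : nat) (u v : J_vertex n k) (t : R) (x y : 'I_n) :
  Rlt R0 t -> PST_at (J_adj n k i) u v t ->
  (x \in val v) = (y \in val v) -> (x \in val u) = (y \in val u).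
Proof.
move=> t0 pst xyv; set s := tperm x y.
have sv : perm_vertex s v = v by apply: val_inj; rewrite SubK tperm_imset_id.
have col r : Hcol (J_adj n k i) v r (perm_vertex s u) t = Hcol (J_adj n k i) v r u t.
  rewrite /Hcol /Hcoef; apply: PSeries_ext => m; congr (expc _ _ _).
  apply: boolp.funext => {}m; rewrite -{1}sv adjpow_aut //.
    exact: perm_vertex_bij.
  exact: J_adj_perm.
have [su|su] := eqVneq (perm_vertex s u) u.
  have -> : (y \in val u) = (s x \in val (perm_vertex s u)) by rewrite su tpermL.
  by rewrite SubK mem_imset //; exact: perm_inj.
have [] := PST_at_Hcol0 (@J_adj_sym _ k i) t0 pst su; rewrite !col => h1 h2.
have := PST_at_Hcol t0 pst; rewrite h1 h2 !mul0r addr0 => /eqP.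
by rewrite eq_sym oner_eq0.
Qed.

(** By separation, membership in u is constant on v and on its complement. If u met v it would
    contain v, hence equal it by cardinality; so u is the whole complement. *)
Lemma PST_at_compl (n k i : nat) (u v : J_vertex n k) (t : R) :
  (0 < k)%N -> Rlt R0 t -> u <> v -> PST_at (J_adj n k i) u v t ->
  val u = ~: val v /\ n = (2 * k)%N.
Proof.
move=> k0 t0 uv pst; have sep := PST_at_separates t0 pst.
have /card_gt0P[x xu] : (0 < #|val u|)%N by rewrite card_J_vertex.
have disj z : z \in val u -> z \notin val v.
  move=> zu; apply/negP => zv; case: uv; apply/val_inj/esym/eqP.
  rewrite eqEcard !card_J_vertex leqnn andbT; apply/subsetP => y yv.
  by rewrite (sep y z) ?yv ?zv.
have uE : val u = ~: val v.
  apply/setP => z; rewrite inE; apply/idP/idP => [/disj //|zv].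
  by rewrite (sep z x) // (negbTE zv) (negbTE (disj _ xu)).
split=> //; have := cardsC (val v); rewrite -uE !card_J_vertex card_ord; lia.
Qed.

(** * Transfer on the perfect matching J(2k, k, 0) *)

Lemma is_series_sin (t : R) :
  is_series (fun j => (-1) ^ j * t ^ (2 * j + 1)%N / INR (fact (2 * j + 1)%N))%coqR (sin t).
Proof.
rewrite /sin; case: exist_sin => c hc.
have /is_series_Reals := hc => /(is_series_scal_l t); apply: is_series_ext => j.
rewrite /sin_n pow_add pow_1 Rsqr_pow2 -pow_mult plusE multE; eqR.
by rewrite -[scal _ _]/(Rmult _ _) /Rdiv; ring.
Qed.

Section Matching.
Variable k : nat.
Hypothesis k0 : (0 < k)%N.
Notation J := (J_vertex (2 * k) k).

Lemma card_setC_vertex (A : J) : #|~: val A| == k.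
Proof. by rewrite card_setC_half // card_J_vertex. Qed.

Definition compl_vertex (A : J) : J := Sub (~: val A) (card_setC_vertex A).

Lemma compl_vertexK : involutive compl_vertex.
Proof. by move=> A; apply: val_inj; rewrite !SubK setCK. Qed.

Lemma J_adj_compl (A B : J) : J_adj (2 * k) k 0 A B = (B == compl_vertex A).
Proof.
rewrite /J_adj cards_eq0 setI_eq0 -val_eqE SubK eqEcard card_J_vertex.
by rewrite (eqP (card_setC_vertex A)) leqnn andbT disjoint_sym disjoints_subset.
Qed.

Lemma adjpow_matching (j : nat) (A B : J) :
  adjpow (J_adj (2 * k) k 0) j A B = (B == if odd j then compl_vertex A else A).
Proof.
elim: j A => [|j IHj] A /=; first by rewrite eq_sym.
rewrite (big_pred1 (compl_vertex A)) => [|C]; last exact: J_adj_compl.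
by rewrite IHj compl_vertexK; case: odd.
Qed.

(** Each vertex is adjacent to its complement only, so A^2 = 1 and H(t) = cos(t) + i sin(t) A, which
    is iA at time PI / 2. *)
Lemma PST_matching : admits_PST (J_adj (2 * k) k 0).
Proof.
pose S := [set x in take k (enum 'I_(2 * k))]; have cS : #|S| == k.
  rewrite cardsE (card_uniqP _) ?take_uniq ?enum_uniq // size_takel //.
  by rewrite size_enum_ord; lia.
pose A : J := Sub S cS; exists A, (compl_vertex A), (PI / 2)%coqR.
have AC : compl_vertex A == A = false.
  apply/eqP => /(congr1 val); rewrite SubK => h.
  have /card_gt0P[x xA] : (0 < #|val A|)%N by rewrite card_J_vertex.
  by have := xA; rewrite -{1}h inE xA.
split; first by move=> h; rewrite -h eqxx in AC.
split; first by have := PI_RGT_0; lra.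
exists R0, (sin (PI / 2)); split; [|split; last by rewrite sin_PI2; ring].
  apply/is_series_Reals; apply: is_series_0 => j.
  by rewrite /H_re_term adjpow_matching oddM /= AC /= /Rdiv; ring.
apply/is_series_Reals; have := @is_series_sin (PI / 2)%coqR; apply: is_series_ext => j.
by rewrite /H_im_term adjpow_matching oddD oddM /= eqxx Rmult_1_r.
Qed.

End Matching.

(** * Eigenvalues and eigenvectors *)

(* Rebinds the tactic ring, which above is the one of Stdlib. *)
From mathcomp Require Import ring.

(** The coefficient L_j of the overview, expanded: s is the degree in x taken from (1 + x)^(k-j).
    For i, j <= k the sign exponent involves no truncated subtraction and has the parity of j - i +
    s. *)
Definition johnson_eig (k i j : nat) : int :=
  \sum_(s < i.+1) (-1) ^+ (k - i + (k - j) + s)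
                  * ('C(k - j, s) ^ 2 * 'C(j, i - s))%N%:R.

Lemma johnson_eig_0 (k i : nat) : (i <= k)%N ->
  johnson_eig k i 0 = ('C(k, i) ^ 2)%N%:R.
Proof.
move=> ik; rewrite /johnson_eig big_ord_recr /= subn0 subnn muln1 big1 ?add0r.
  by rewrite addnAC subnK // addnn -signr_odd odd_double mul1r.
by move=> s _; rewrite bin0n subn_eq0 leqNgt ltn_ord muln0 mulr0.
Qed.

Lemma johnson_eig_1 (k i : nat) : (i < k)%N ->
  johnson_eig k.+1 i.+1 1 = ('C(k, i) ^ 2)%N%:R - ('C(k, i.+1) ^ 2)%N%:R.
Proof.
move=> ik; rewrite /johnson_eig !big_ord_recr /= subSS subSnn subnn bin0 binn.
rewrite !muln1 big1 ?add0r; last first.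
  by move=> s _; rewrite (@bin_small 1) ?muln0 ?mulr0 //; have := ltn_ord s; lia.
have e1 : ~~ odd (k - i + k + i) by lia.
by rewrite subn1 /= addnS exprS -signr_odd (negbTE e1) mul1r mulr1 mulN1r.
Qed.

Lemma johnson_eig_k (k i : nat) :
  johnson_eig k i k = (-1) ^+ (k - i) * ('C(k, i))%N%:R.
Proof.
rewrite /johnson_eig big_ord_recl /= subnn bin0 mul1n subn0 !addn0 big1 ?addr0 //.
by move=> s _; rewrite bin0n mul0n mulr0.
Qed.

Lemma johnson_eig_pred (k i : nat) :
  johnson_eig k.+1 i.+1 k
  = (-1) ^+ (k - i) * ('C(k, i)%N%:R - ('C(k, i.+1))%N%:R).
Proof.
rewrite /johnson_eig !big_ord_recl /= subSS subSnn bin0 bin1 big1 ?addr0 //; last first.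
  by move=> s _; rewrite bin_small // mul0n mulr0.
rewrite !exp1n !mul1n /bump /= subn0 subn1 /= addn0 !addn1 !exprS; ring.
Qed.

(** With a = C(k, i) and b = C(k, i+1), Pascal's rule makes this (a + b)^2 - (a^2 - b^2) = 2 (a + b)
    b. *)
Lemma johnson_eig_0B1 (k i : nat) : (i < k)%N ->
  johnson_eig k.+1 i.+1 0 - johnson_eig k.+1 i.+1 1
  = (2 * 'C(k.+1, i.+1) * 'C(k, i.+1))%N%:R.
Proof.
move=> ik; rewrite johnson_eig_1 // johnson_eig_0 1?ltnW // binS.
by rewrite !natrM !natrD; ring.
Qed.

Lemma johnson_eig_kBpred (k i : nat) :
  johnson_eig k.+1 i.+1 k.+1 - johnson_eig k.+1 i.+1 k
  = (-1) ^+ (k - i) * (2 * 'C(k, i.+1))%N%:R.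
Proof.
by rewrite johnson_eig_k johnson_eig_pred binS subSS natrM natrD; ring.
Qed.

(** With m = 2^(a+1), Vandermonde splits C(k, i) into the terms C(m, s) C(k-m, i-s), matched one by
    one with those of L_(k-m). Modulo 4 only s = 2^a remains, and it is twice an odd number. *)
Lemma johnson_eig_kBpow2 (k i a : nat) : (2 ^ a.+1 <= k)%N -> (2 ^ a <= i)%N ->
  odd 'C(k - 2 ^ a.+1, i - 2 ^ a) ->
  exists2 d : int, johnson_eig k i k - johnson_eig k i (k - 2 ^ a.+1) = 2 * d
                 & odd `|d|.
Proof.
have em : odd (2 ^ a.+1) = false by rewrite expnS oddM.
have bin4 := @dvdn4_bin_pow2 a; have [q oq Eq] := bin_pow2_mod4 a.
move: (2 ^ a.+1)%N (2 ^ a)%N em bin4 Eq => m h em bin4 Eq mk hi oC.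
(* C(m, s) (1 - (-1)^s C(m, s)) is divisible by 4 unless s = m / 2. *)
pose F (s : nat) : int :=
  'C(m, s)%:R * (1 - (-1) ^+ s * 'C(m, s)%:R) * 'C(k - m, i - s)%:R.
have -> : johnson_eig k i k - johnson_eig k i (k - m)
          = (-1) ^+ (k - i) * \sum_(s < i.+1) F s.
  rewrite johnson_eig_k -{2}(subnKC mk) -binomial.Vandermonde natr_sum mulr_sumr.
  rewrite /johnson_eig -sumrB mulr_sumr; apply: eq_bigr => s _.
  by rewrite subKn // !exprD -(signr_odd _ m) em /F !natrM expr0; ring.
have hi' : (h < i.+1)%N by rewrite ltnS.
rewrite (bigD1 (Ordinal hi')) //=.
have /dvdzP[z ->] : (4 %| \sum_(s < i.+1 | s != Ordinal hi') F s)%Z.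
  apply: rpred_sum => s; rewrite -val_eqE /= => /eqP ns.
  have [s0|s0] := posnP s; first by rewrite /F s0 bin0 expr0 mul1r subrr mulr0 mul0r.
  have [sm|sm|sm] := ltngtP s m.
  - rewrite /F -mulrA; apply: dvdz_mulr; rewrite dvdzE !natz; exact: bin4.
  - by rewrite /F bin_small // !mul0r.
  - by rewrite /F sm binn mulr1 -signr_odd em subrr mulr0 mul0r.
rewrite /F Eq; move: oC; set c := 'C(_, _) => oC.
exists ((-1) ^+ (k - i) * (q%:R * (1 - (-1) ^+ h * q.*2%:R) * c%:R + z * 2)).
  by rewrite -!mul2n natrM; ring.
rewrite -(signr_odd _ h) -(signr_odd _ (k - i)) !natz.
by case: (odd h); case: (odd (k - i)); rewrite ?expr1 ?expr0; nia.
Qed.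

Lemma coef_exprDX (R : comNzRingType) (c : R) (j d : nat) :
  ((c%:P + 'X) ^+ j)`_d = c ^+ (j - d) *+ 'C(j, d).
Proof.
have -> : (c%:P + 'X) ^+ j = \poly_(d < j.+1) (c ^+ (j - d) *+ 'C(j, d)).
  rewrite exprDn poly_def; apply: eq_bigr => s _.
  by rewrite -rmorphXn /= mul_polyC scalerMnl.
by rewrite coef_poly ltnS; case: leqP => // jd; rewrite bin_small.
Qed.

(** The outer variable ['X] plays x, the inner one [('X)%:P] plays y. Both (1 + x)^(k-j) and (1 +
    y)^(k-j) contribute C(k-j, s), which explains the square. *)
Lemma coef_johnson_eig (k i j : nat) : (i <= k)%N -> (j <= k)%N ->
  ((('X - ('X)%:P) ^+ j * ((1 + 'X) * (1 + ('X)%:P)) ^+ (k - j)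
     : {poly {poly int}})`_i)`_(k - i) = johnson_eig k i j.
Proof.
move=> ik jk; set m := (k - j)%N.
have -> : ('X - ('X)%:P) ^+ j * ((1 + 'X) * (1 + ('X)%:P)) ^+ m =
  (1%:P + 'X) ^+ m * ((- 'X)%:P + 'X) ^+ j * ((1 + 'X) ^+ m)%:P :> {poly {poly int}}.
  by rewrite exprMn polyCN rmorphXn rmorphD /= [- _ + _]addrC mulrA [_ ^+ j * _]mulrC.
rewrite coefMC (coefM _ _ i) mulr_suml coef_sum; apply: eq_bigr => s _.
rewrite !coef_exprDX expr1n [(- 'X) ^+ _]exprNn.
have -> : 1 *+ 'C(m, s) * ((-1) ^+ (j - (i - s)) * 'X ^+ (j - (i - s)) *+ 'C(j, i - s))
    * (1 + 'X) ^+ m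
  = ((-1) ^+ (j - (i - s)) * ('C(m, s) * 'C(j, i - s))%N%:R)%:P
    * (('X + 1) ^+ m * 'X ^+ (j - (i - s))) :> {poly int}.
  rewrite rmorphM rmorphXn rmorphN1 /= natrM rmorphM /= !rmorph_nat.
  by rewrite -mulrnAr -[_ *+ 'C(j, _)]mulr_natr [1 + _]addrC; ring.
have c1 d : (('X + 1 : {poly int}) ^+ m)`_d = 'C(m, d)%:R.
  by rewrite addrC -polyC1 coef_exprDX expr1n.
rewrite coefCM coefMXn c1.
(* Outside the range of the binomials both sides vanish; inside it the truncated subtractions are
   exact. *)
have [sm|sm] := ltnP m s.
  by rewrite (bin_small sm) !mul0n !(mulr0, mul0r).
have [ji|ij] := ltnP j (i - s).
  by rewrite (bin_small ji) !muln0 !(mulr0, mul0r).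
have si := ltn_ord s.
rewrite ifF; last by lia.
have -> : (k - i - (j - (i - s)) = m - s)%N by lia.
rewrite bin_sub // -signr_odd -[in RHS]signr_odd.
have -> : odd (k - i + m + s) = odd (j - (i - s)) by lia.
by rewrite -mulrA -natrM mulnAC.
Qed.

(** * Eigenvectors from a pairing *)

Definition pair_sign (T : finType) (k : nat) (e : 'I_k * bool -> T) (B : {set T})
  (l : 'I_k) : int := (e (l, true) \in B)%:R - (e (l, false) \in B)%:R.

(** Zero unless [B] splits each of the first j pairs. It is defined on sets of every size, so that
    sums over [B] factor over the pairs. *)
Definition pair_fun (T : finType) (k : nat) (e : 'I_k * bool -> T) (j : nat)
  (B : {set T}) : int := \prod_(l < k | (l < j)%N) pair_sign e B l.

Lemma big_pairing (T : finType) (k : nat) (e : 'I_k * bool -> T) (A : comNzRingType)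
  (F : T -> A) : bijective e ->
  \prod_x F x = \prod_(l < k) (F (e (l, true)) * F (e (l, false))).
Proof.
move=> eb; rewrite (reindex e) /=; last exact: onW_bij.
transitivity (\prod_(l < k) \prod_(b : bool) F (e (l, b))).
  by rewrite pair_bigA; apply: eq_bigr => [[]].
by apply: eq_bigr => l _; rewrite big_bool.
Qed.

(** A set [B] amounts to an independent choice among four traces on each pair. For the first j pairs
    the signs cancel the empty and the full trace. *)
Lemma sum_pair_fun_prod (T : finType) (k : nat) (e : 'I_k * bool -> T)
  (A : comNzRingType) (z : T -> A) (j : nat) : bijective e ->
  \sum_(B : {set T}) (pair_fun e j B)%:~R * \prod_(x in B) z x
  = \prod_(l < k) (if (l < j)%N then z (e (l, true)) - z (e (l, false))
                   else (1 + z (e (l, true))) * (1 + z (e (l, false)))).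
Proof.
move=> eb; have [g eK gK] := eb.
pose h (f : {ffun 'I_k -> bool * bool}) : {set T} :=
  [set x | if (g x).2 then (f (g x).1).1 else (f (g x).1).2].
pose h' (B : {set T}) : {ffun 'I_k -> bool * bool} :=
  [ffun l => (e (l, true) \in B, e (l, false) \in B)].
have ht f l : (e (l, true) \in h f) = (f l).1 by rewrite inE eK.
have hf f l : (e (l, false) \in h f) = (f l).2 by rewrite inE eK.
have hK : cancel h h'.
  by move=> f; apply/ffunP=> l; rewrite ffunE ht hf; case: (f l).
have h'K : cancel h' h.
  move=> B; apply/setP=> x; rewrite inE ffunE /=.
  by rewrite -{4}(gK x); case: (g x) => l [].
rewrite (reindex h) /=; last by apply: onW_bij; exists h'.
pose G (l : 'I_k) (b : bool * bool) : A :=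
  (if (l < j)%N then b.1%:R - b.2%:R else 1)
  * ((if b.1 then z (e (l, true)) else 1) * (if b.2 then z (e (l, false)) else 1)).
transitivity (\sum_(f : {ffun 'I_k -> bool * bool}) \prod_l G l (f l)).
  apply: eq_bigr => f _; rewrite /G big_split /= -big_mkcond /=; congr (_ * _).
    rewrite /pair_fun rmorph_prod; apply: eq_bigr => l _.
    by rewrite /pair_sign ht hf rmorphB /= !rmorph_nat.
  rewrite big_mkcond (big_pairing _ eb) //.
  by apply: eq_bigr => l _; rewrite ht hf.
rewrite -bigA_distr_bigA /=; apply: eq_bigr => l _.
rewrite (eq_bigr (fun p => G l (p.1, p.2))); last by case.
rewrite -(pair_bigA _ (fun b1 b2 => G l (b1, b2))) /= !big_bool /G /=.
by case: ifP => _; rewrite ?subrr; ring.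
Qed.

Lemma prod_two_valued (T : finType) (A : comNzRingType) (S B : {set T}) (x y : A) :
  \prod_(p in B) (if p \in S then x else y)
  = x ^+ #|S :&: B| * y ^+ (#|B| - #|S :&: B|).
Proof.
rewrite (big_setID S) /= setIC; congr (_ * _).
  by rewrite (eq_bigr (fun=> x)) ?prodr_const // => p; rewrite inE => /andP[->].
rewrite (eq_bigr (fun=> y)) ?prodr_const ?cardsD 1?setIC //.
by move=> p; rewrite inE => /andP[/negbTE->].
Qed.

Lemma pair_sign_diff (T : finType) (k : nat) (e : 'I_k * bool -> T) (S : {set T})
  (A : comNzRingType) (x y : A) (l : 'I_k) :
  (if e (l, true) \in S then x else y) - (if e (l, false) \in S then x else y)
  = (pair_sign e S l)%:~R * (x - y).
Proof. by rewrite /pair_sign; do 2!case: ifP => _ /=; ring. Qed.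

Lemma pair_fun_splits (T : finType) (k : nat) (e : 'I_k * bool -> T) (j : nat)
  (S : {set T}) (A : comNzRingType) (x y : A) (l : 'I_k) :
  pair_fun e j S != 0 -> (l < j)%N ->
  (if e (l, true) \in S then x else y) * (if e (l, false) \in S then x else y) = x * y.
Proof.
rewrite /pair_fun => /prodf_neq0 /(_ l) h /h; rewrite /pair_sign.
by do 2!case: ifP => _ //=; rewrite mulrC.
Qed.

Lemma prod_ord_lt_const (A : comNzRingType) (k j : nat) (c : A) : (j <= k)%N ->
  \prod_(l < k | (l < j)%N) c = c ^+ j.
Proof.
by move=> jk; rewrite -(big_ord_widen k (fun=> c) jk) prodr_const card_ord.
Qed.

(** Elements of [S] get weight x and the others y, so the monomial of [B] records its intersection
    with [S] and its size. *)
Lemma sum_pair_fun_set (T : finType) (k : nat) (e : 'I_k * bool -> T)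
  (S : {set T}) (j : nat) : bijective e -> #|S| = k -> (j <= k)%N ->
  \sum_(B : {set T}) (pair_fun e j B)%:~R
     * ('X ^+ #|S :&: B| * ('X)%:P ^+ (#|B| - #|S :&: B|))
  = (pair_fun e j S)%:~R
     * (('X - ('X)%:P) ^+ j * ((1 + 'X) * (1 + ('X)%:P)) ^+ (k - j)) :> {poly {poly int}}.
Proof.
move=> eb Sk jk; pose z p : {poly {poly int}} := if p \in S then 'X else ('X)%:P.
under eq_bigr do rewrite -prod_two_valued -/(z _).
rewrite (sum_pair_fun_prod z _ eb) (bigID (fun l : 'I_k => (l < j)%N)) /=.
rewrite (eq_bigr (fun l => (pair_sign e S l)%:~R * ('X - ('X)%:P))); last first.
  by move=> l ->; rewrite pair_sign_diff.
rewrite big_split /= -rmorph_prod prod_ord_lt_const //= -/(pair_fun e j S) -!mulrA.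
have [->|nz] := eqVneq (pair_fun e j S) 0; first by rewrite !mul0r.
congr (_ * (_ * _)).
rewrite (eq_bigr (fun l => (1 + z (e (l, true))) * (1 + z (e (l, false))))); last first.
  by move=> l /negbTE->.
pose W : {poly {poly int}} := (1 + 'X) * (1 + ('X)%:P).
have X0 (A : comNzRingType) : 1 + 'X != 0 :> {poly A}.
  by rewrite addrC -polyC1 monic_neq0 ?monicXaddC.
have W0 : W ^+ j != 0.
  by rewrite expf_neq0 // mulf_neq0 ?X0 // -polyC1 -polyCD polyC_eq0 X0.
(* The first j pairs are split by S, so the product over the others is the product
   of 1 + z over the whole ground set divided by W^j. *)
apply: (mulfI W0); rewrite -/W -exprD subnKC //.
rewrite -(@prod_ord_lt_const _ k j) //.
have -> : \prod_(l < k | (l < j)%N) W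
  = \prod_(l < k | (l < j)%N) ((1 + z (e (l, true))) * (1 + z (e (l, false)))).
  apply: eq_bigr => l lj; rewrite /W -(pair_fun_splits (1 + 'X) _ nz lj) /z.
  by do 2!case: ifP.
have := big_pairing (fun p => 1 + z p) eb.
rewrite (bigID (fun l : 'I_k => (l < j)%N)) /= => <-.
have := prod_two_valued S setT (1 + 'X) (1 + ('X)%:P : {poly {poly int}}).
have -> : #|[set: T]| = (k + k)%N.
  by rewrite cardsT -(bij_eq_card eb) card_prod card_ord card_bool muln2 addnn.
rewrite setIT Sk addnK exprMn => <-.
by apply: eq_big => [p|p _]; rewrite ?inE // /z; case: ifP.
Qed.

(** The coefficient of x^i y^(k-i) in [sum_pair_fun_set] selects exactly the k-sets that meet [S] in
    i elements. *)
Lemma pair_fun_eigen (T : finType) (k i : nat) (e : 'I_k * bool -> T)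
  (S : {set T}) (j : nat) : bijective e -> #|S| = k -> (j <= k)%N -> (i <= k)%N ->
  \sum_(B : {set T} | (#|B| == k) && (#|S :&: B| == i)) pair_fun e j B
  = johnson_eig k i j * pair_fun e j S.
Proof.
move=> eb Sk jk ik; rewrite -coef_johnson_eig //.
have := congr1 (fun p : {poly {poly int}} => p`_i`_(k - i)) (sum_pair_fun_set eb Sk jk).
rewrite mulrzl !coefMrz mulrzz => <-.
rewrite !coef_sum big_mkcond; apply: eq_bigr => B _.
rewrite mulrzl !coefMrz mulrzz -rmorphXn /= coefMC coefXn.
have -> : (#|B| == k) && (#|S :&: B| == i)
  = (i == #|S :&: B|) && ((k - i)%N == (#|B| - #|S :&: B|)%N).
  have : (#|S :&: B| <= #|B|)%N by rewrite subset_leq_card ?subsetIr.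
  by move=> h; apply/andP/andP => [[/eqP h1 /eqP h2]|[/eqP h1 /eqP h2]]; split; apply/eqP; lia.
case: eqP => _ /=; last by rewrite mul0r coef0 mul0r.
by rewrite mul1r coefXn; case: eqP => _; rewrite ?mul1r ?mul0r.
Qed.

Lemma pair_fun_half (k : nat) (S : {set 'I_(2 * k)}) (cardS : #|S| = k) (j : nat) :
  (j <= k)%N -> pair_fun (half_pairing cardS) j S = 1
  /\ pair_fun (half_pairing cardS) j (~: S) = (-1) ^+ j.
Proof.
move=> jk; rewrite -(@prod_ord_lt_const _ k) // /pair_fun; split.
  by rewrite big1 // => l _; rewrite /pair_sign !half_pairing_in.
by apply: eq_bigr => l _; rewrite /pair_sign !inE !half_pairing_in.
Qed.

Lemma J_adj_eigen (n k i j : nat) (e : 'I_k * bool -> 'I_n) (A : J_vertex n k) :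
  bijective e -> (j <= k)%N -> (i <= k)%N ->
  \sum_(B | J_adj n k i A B) (pair_fun e j (val B))%:~R
  = (johnson_eig k i j)%:~R * (pair_fun e j (val A))%:~R :> R.
Proof.
move=> eb jk ik; rewrite -rmorphM -(@pair_fun_eigen _ _ _ _ (val A)) ?card_J_vertex //.
rewrite rmorph_sum /= [RHS](reindex_omap (val : J_vertex n k -> _) insub) /=.
  by apply: eq_bigl => B; rewrite valK eqxx (valP B) andbT.
by move=> B /andP[Bk _]; rewrite insubT.
Qed.

(** * Parity contradiction for 0 < i < k *)

Lemma cos_mul_pm1 (x c : R) (n : nat) : cos x = c -> c * c = 1 ->
  cos (n%:R * x)%R = c ^+ n.
Proof.
move=> cx cc; have s0 : sin x = 0.
  have := sin2_cos2 x; rewrite cx /Rsqr !RmultE cc => /(canRL (addrK _)).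
  by rewrite R1E subrr => /eqP; rewrite mulf_eq0 orbb => /eqP.
elim: n => [|n IHn]; first by rewrite mul0r -R0E cos_0.
by rewrite -natr1 mulrDl mul1r cosD IHn s0 mulr0 subr0 cx exprSr.
Qed.

Lemma cos_intr_abs (d : int) (x : R) : cos (d%:~R * x)%R = cos (`|d|%N%:R * x)%R.
Proof.
by case: d => n //; rewrite NegzE mulrNz mulNr -RoppE cos_neg.
Qed.

Lemma johnson_eig_cos_absurd (k i : nat) (t : R) : (0 < i < k)%N ->
  (forall j l, (j <= k)%N -> (l <= k)%N ->
     cos ((johnson_eig k i j - johnson_eig k i l)%:~R * t)%R = (-1) ^+ (j + l)) ->
  False.
Proof.
move=> /andP[i0 ik] hcos; have sq1 : -1 * -1 = 1 :> R by rewrite mulrNN mulr1.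
case: i i0 ik hcos => // i _; case: k => // k ik hcos.
set c := 'C(k, i.+1).
have cosc : cos (2 * c%:R * t)%R = -1.
  have := hcos k.+1 k (leqnn _) (leqnSn _).
  rewrite johnson_eig_kBpred cos_intr_abs abszMsign natz absz_nat natrM => ->.
  by rewrite addSn exprS addnn -signr_odd odd_double mulr1.
have oC : odd 'C(k.+1, i.+1).
  have := hcos 0%N 1%N (leq0n _) (ltn0Sn _).
  rewrite johnson_eig_0B1 // cos_intr_abs natz absz_nat.
  (* The angle is C(k+1, i+1) times one of cosine -1, while the indices 0 and 1 prescribe cosine -1:
     the multiplier is odd. *)
  have -> : (2 * 'C(k.+1, i.+1) * c)%N%:R * t = 'C(k.+1, i.+1)%:R * (2 * c%:R * t) :> R.
    by rewrite !natrM -!mulrA mulrCA.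
  rewrite (cos_mul_pm1 _ cosc sq1) expr1 -signr_odd; case: odd => // /eqP.
  by rewrite expr0 -subr_eq0 opprK -(natrD _ 1 1) pnatr_eq0.
have [a [ak ai oa]] := odd_bin_descent (ltn0Sn i) ik oC.
have [d dE od] := johnson_eig_kBpow2 ak ai oa.
have := hcos _ _ (leqnn k.+1) (leq_subr (2 ^ a.+1) k.+1).
have -> : (-1) ^+ (k.+1 + (k.+1 - 2 ^ a.+1)) = 1 :> R.
  rewrite -signr_odd (_ : odd _ = false) //.
  by move: ak; rewrite expnS; move: (2 ^ a)%N => p; lia.
rewrite dE cos_intr_abs abszM natrM (_ : `|2|%N = 2%N) // => cosd.
have swap (x y z w : R) : x * (y * z * w) = z * (y * x * w).
  by rewrite -!mulrA [LHS]mulrCA [RHS]mulrCA [x * (z * w)]mulrCA.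
(* The angle 2 c |d| t is evaluated twice: as c times 2 |d| t its cosine is 1, as the odd multiple
   |d| of 2 c t it is -1. *)
have := cos_mul_pm1 c cosd (mulr1 _); rewrite expr1n swap.
rewrite (cos_mul_pm1 _ cosc sq1) -signr_odd od expr1 => /eqP.
by rewrite eq_sym -subr_eq0 opprK -(natrD _ 1 1) pnatr_eq0.
Qed.

Lemma PST_at_i0 (n k i : nat) (u v : J_vertex n k) (t : R) :
  (0 < k)%N -> (i < k)%N -> Rlt R0 t -> u <> v -> PST_at (J_adj n k i) u v t -> i = 0%N.
Proof.
move=> k0 ik t0 uv pst; have [uE nE] := PST_at_compl k0 t0 uv pst.
subst n; case: (posnP i) => // i0; exfalso.
have cv := card_J_vertex v; pose e := half_pairing cv.
pose re := Hcol (J_adj _ k i) v rho u t; pose im := Hcol (J_adj _ k i) v sgm u t.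
have h j : (j <= k)%N -> cos ((johnson_eig k i j)%:~R * t)%R = (-1) ^+ j * re
                        /\ sin ((johnson_eig k i j)%:~R * t)%R = (-1) ^+ j * im.
  move=> jk; have := PST_at_eigen (@J_adj_sym _ k i) t0 pst
    (fun A => J_adj_eigen A (half_pairing_bij cv) jk (ltnW ik)).
  have [hv hu] := pair_fun_half cv jk.
  by rewrite uE hu hv rmorphXn rmorphN1 !mul1r => -[<- <-].
apply: (@johnson_eig_cos_absurd k i t); first by rewrite i0.
move=> j l /h[cj sj] /h[cl sl].
(* In the difference of two angles the unknown phase enters only through re^2 + im^2 = 1. *)
rewrite rmorphB /= mulrBl -[X in cos X]/(Rminus _ _) cos_minus cj sj cl sl !RmultE RplusE.
rewrite mulrACA [X in _ + X]mulrACA -mulrDr -exprD.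
by rewrite (PST_at_Hcol t0 pst) mulr1.
Qed.

Theorem mainTheorem4 (n k i : nat) :
  (1 <= k)%N -> (2 * k <= n)%N -> (i < k)%N ->
  (admits_PST (J_adj n k i) <-> n = (2 * k)%N /\ i = 0%N).
Proof.
move=> k0 kn ik; split=> [[u [v [t [uv [t0 pst]]]]]|[-> ->]].
  by split; [case: (PST_at_compl k0 t0 uv pst) | exact: PST_at_i0 pst].
exact: PST_matching.
Qed.
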